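(* Let $k \geq 2$ and $0 \leq j \leq k-1$ be integers. For all $n \geq j+1$, $$B_n(k,j) = - \sum_{i=1}^{\lfloor \frac{n+1}{k+1} \rfloor} (-1)^i \binom{n-ik}{i-1} 2^{n+1-i(k+1)} + \sum_{i=1}^{\lfloor \frac{n-j}{k+1} \rfloor} (-1)^i \binom{n-j-1-ik}{i-1} 2^{n-j-i(k+1)}.$$
   Context: For integers $k \geq 2$ and $0 \leq j \leq k-1$, the sequence $\{B_n(k,j)\}_{n\geq 0}$ is defined by the recurrence $B_n(k,j) = B_{n-1}(k,j) + B_{n-2}(k,j)+\dots+B_{n-k}(k,j)$ for all $n \geq k$, with initial values $B_j(k,j)=1$ and $B_i(k,j)=0$ for $0 \leq i \leq k-1$, $i \neq j$. Empty sums are $0$. *)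

(* Defs.v *)
From HB Require Import structures.
From mathcomp Require Import all_boot all_order all_algebra.

Set Implicit Arguments.
Unset Strict Implicit.
Unset Printing Implicit Defensive.

Import GRing.Theory.
Local Open Scope ring_scope.

(* [kbonacci_seq k j n] is the list [:: B_0(k,j); ...; B_{n-1}(k,j)]; the
   recursion keeps all earlier terms because the recurrence has order [k].   *)
Fixpoint kbonacci_seq (k j n : nat) : seq int :=
  if n is m.+1 then
    let s := kbonacci_seq k j m in
    rcons s (if (m < k)%N then (if m == j then 1 else 0)
             else \sum_(1 <= i < k.+1) s`_(m - i)%N)
  else [::].

Definition kbonacci (k j n : nat) : int := (kbonacci_seq k j n.+1)`_n.

Lemma size_kbonacci_seq k j n : size (kbonacci_seq k j n) = n.
Proof. by elim: n => //= n IHn; rewrite size_rcons IHn. Qed.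

Lemma nth_kbonacci_seq k j n m :
  (m < n)%N -> (kbonacci_seq k j n)`_m = kbonacci k j m.
Proof.
elim: n => // n IHn; rewrite ltnS leq_eqVlt => /predU1P[-> //|lt_mn].
by rewrite /= nth_rcons size_kbonacci_seq lt_mn IHn.
Qed.

Lemma kbonacci_init k j n :
  (n < k)%N -> kbonacci k j n = if n == j then 1 else 0.
Proof.
by move=> lt_nk; rewrite /kbonacci /= nth_rcons size_kbonacci_seq ltnn eqxx lt_nk.
Qed.

Lemma kbonacci_rec k j n : (0 < k)%N -> (k <= n)%N ->
  kbonacci k j n = \sum_(1 <= i < k.+1) kbonacci k j (n - i)%N.
Proof.
move=> k_gt0 le_kn.
rewrite {1}/kbonacci /= nth_rcons size_kbonacci_seq ltnn eqxx ltnNge le_kn /=.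
apply: eq_big_nat => i /andP[i_gt0 _]; apply: nth_kbonacci_seq.
by rewrite ltn_subrL i_gt0 (leq_trans k_gt0 le_kn).
Qed.

(* Main.v *)
(* Subtracting consecutive instances of the recurrence gives
   B_(n+1) = 2 B_n - B_(n-k) for n >= k.  The fundamental solution of this
   recurrence, with generating function 1 / (1 - 2x + x^(k+1)), is expanded as
   a geometric series in x^(k+1) / (1 - 2x); its coefficients F_p are the
   alternating binomial sums of the theorem, shifted by k+1.  Setting
   F_p = 0 for p < 0, one gets B_n = F_(n-k) - F_(n-j-k-1) + [n = j]
   for all n >= 0 by comparing initial values. *)
Require Import Defs.
From HB Require Import structures.
From mathcomp Require Import all_boot all_order all_algebra.
From mathcomp Require Import zify ring.

Import GRing.Theory.
Local Open Scope ring_scope.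

Lemma kbonacci_rec2 k j n : (0 < k)%N -> (k <= n)%N ->
  kbonacci k j n.+1 = 2%:Z * kbonacci k j n - kbonacci k j (n - k).
Proof.
move=> k_gt0 le_kn.
have le_kn1 : (k <= n.+1)%N by rewrite leqW.
rewrite (kbonacci_rec _ k_gt0 le_kn1) big_nat_recl // subn1 /=.
under eq_big_nat => i _ do rewrite subSS.
(* What is left of the sum for B_(n+1) is B_(n-1) + ... + B_(n-k+1), which is B_n - B_(n-k). *)
have := kbonacci_rec j k_gt0 le_kn; case: k k_gt0 {le_kn le_kn1} => // k _ E.
rewrite big_nat_recr //= in E.
rewrite [X in X * _](_ : _ = 1 + 1) // mulrDl mul1r -addrA; congr (_ + _).
by rewrite [X in _ = X - _]E addrK.
Qed.

(** The coefficient of x^p in (-1)^i x^(i(k+1)) / (1 - 2x)^(i+1). *)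
Definition altbin_term (k p i : nat) : int :=
  (-1) ^+ i * 'C(p - i * k, i)%:Z * 2%:Z ^+ (p - i * k.+1).

Definition altbin (k p : nat) : int :=
  \sum_(0 <= i < (p %/ k.+1).+1) altbin_term k p i.

Lemma altbin_term0 k p : altbin_term k p 0 = 2%:Z ^+ p.
Proof. by rewrite /altbin_term !mul0n !subn0 bin0 !mul1r. Qed.

Lemma altbin_term_eq0 k p i : (p < i * k.+1)%N -> altbin_term k p i = 0.
Proof.
move=> lt_p; rewrite /altbin_term bin_small ?mulr0 ?mul0r //.
by rewrite mulnS in lt_p; case: i lt_p => [|i] //; lia.
Qed.

(** Lets sums for different p share one range, so that they can be compared term by term. *)
Lemma altbin_widen k p N : (p < N)%N ->
  altbin k p = \sum_(0 <= i < N) altbin_term k p i.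
Proof.
move=> lt_pN; have le_N : ((p %/ k.+1).+1 <= N)%N.
  by apply: leq_trans lt_pN; rewrite ltnS leq_div.
rewrite (big_cat_nat (leq0n _) le_N) /= [X in _ + X]big_nat [X in _ + X]big1 ?addr0 // => i.
by rewrite ltn_divLR // => /andP[lt_p _]; apply: altbin_term_eq0.
Qed.

(** Pascal's rule on the binomial: one part is the same term at p, the other is the preceding term
    at p - k. *)
Lemma altbin_termS k p i :
  altbin_term k p.+1 i.+1 =
    2%:Z * altbin_term k p i.+1
    - (if (k <= p)%N then altbin_term k (p - k) i else 0).
Proof.
have [le_ip|lt_pi] := leqP (i.+1 * k) p; last first.
  have -> : altbin_term k p.+1 i.+1 = 0.
    by apply: (@altbin_term_eq0 k); rewrite mulnS; lia.
  rewrite altbin_term_eq0 ?mulr0 ?sub0r; last by rewrite mulnS; lia.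
  case: ifP => [le_kp|_]; rewrite ?oppr0 //.
  by rewrite altbin_term_eq0 ?oppr0 // mulnS; rewrite mulSn in lt_pi; nia.
have le_kp : (k <= p)%N by rewrite mulSn in le_ip; lia.
rewrite le_kp /altbin_term subSn // binS PoszD.
have -> : (p - k - i * k = p - i.+1 * k)%N by rewrite mulSn subnDA.
have -> : (p - k - i * k.+1 = p.+1 - i.+1 * k.+1)%N by rewrite !mulnS !mulSn; lia.
(* If p < (i+1)(k+1), the exponent of 2 at p is truncated and no factor 2 can be split off, but the
   binomial at p is then 0. *)
have [lt_p|le_p] := ltnP p (i.+1 * k.+1).
  by rewrite (@bin_small _ i.+1) ?exprS; [ring | rewrite mulnS in lt_p; lia].
by rewrite subSn // !exprS; ring.
Qed.

Lemma altbin0 k : altbin k 0 = 1.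
Proof. by rewrite /altbin div0n big_nat1 altbin_term0. Qed.

Lemma altbinS k p :
  altbin k p.+1 =
    2%:Z * altbin k p - (if (k <= p)%N then altbin k (p - k) else 0).
Proof.
rewrite (@altbin_widen k p.+1 p.+2) // (@altbin_widen k p p.+2) //.
rewrite !(big_nat_recl p.+1) // !altbin_term0 mulrDr -exprS -addrA.
congr (_ + _); under eq_bigr do rewrite altbin_termS.
rewrite sumrB mulr_sumr; congr (_ - _).
case: ifP => [le_kp|_]; last by rewrite big1.
by rewrite (@altbin_widen _ _ p.+1) // ltnS leq_subr.
Qed.

Definition altbin_shift (k m : nat) : int :=
  if (m <= k)%N then 0 else altbin k (m - k.+1).

(* Truncated subtraction is harmless here since [altbin_shift k 0 = 0]. *)
Lemma altbin_shiftS k m :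
  altbin_shift k m.+1 =
    2%:Z * altbin_shift k m - altbin_shift k (m - k) + (m == k)%:R.
Proof.
rewrite /altbin_shift; have [lt_mk|lt_km|->] := ltngtP m k.
- have -> : (m - k <= k)%N by lia.
  by rewrite mulr0 subr0 addr0.
- have -> : (m.+1 - k.+1 = (m - k.+1).+1)%N by lia.
  rewrite altbinS addr0; congr (_ - _).
  have -> : (m - k - k.+1 = m - k.+1 - k)%N by lia.
  have [le_k|lt_k] := leqP (m - k) k; last by rewrite ifT //; lia.
  by case: ifP => // ?; lia.
- by rewrite !subnn altbin0 mulr0 subr0 add0r.
Qed.

(** Replacing i by i+1 gives the terms of F_(m-k-1), and the extra factor -1 gives the sign. Both
    sums of the theorem have this form, with m = n+1 and m = n-j. *)
Lemma sum_altbin_shift k m :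
  \sum_(1 <= i < (m %/ (k + 1)).+1)
     (-1) ^+ i * 'C(m - 1 - i * k, i - 1)%:Z * 2%:Z ^+ (m - i * (k + 1))
  = - altbin_shift k m.
Proof.
rewrite addn1 /altbin_shift; case: leqP => [le_mk|lt_km].
  by rewrite divn_small ?ltnS // big_geq ?oppr0.
have -> : (m %/ k.+1 = ((m - k.+1) %/ k.+1).+1)%N.
  by rewrite -[in LHS](subnK lt_km) divnDr // divnn addn1.
rewrite big_add1 /= /altbin -sumrN; apply: eq_bigr => i _.
rewrite /altbin_term subn1 /= subn1 exprS mulN1r !mulNr /=.
have -> : (m.-1 - i.+1 * k = m - k.+1 - i * k)%N by rewrite mulSn; lia.
by have -> : (m - i.+1 * k.+1 = m - k.+1 - i * k.+1)%N by rewrite mulSn; lia.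
Qed.

Lemma kbonacci_altbin_shift k j n : (j < k)%N ->
  kbonacci k j n = altbin_shift k n.+1 - altbin_shift k (n - j) + (n == j)%:R.
Proof.
move=> lt_jk; elim/ltn_ind: n => n IHn.
have shift0 m : (m <= k)%N -> altbin_shift k m = 0 by rewrite /altbin_shift => ->.
have k_gt0 : (0 < k)%N by lia.
have [lt_nk|le_kn] := ltnP n k.
  rewrite kbonacci_init // !shift0 ?subr0 ?add0r; [by case: eqP | lia | lia].
case: n IHn le_kn => [|n] IHn le_kn; first by lia.
have [lt_nk|{}le_kn] := ltnP n k.
  (* At index k the two-term recurrence does not apply yet. The full sum runs over the initial
     values, and only i = k-j contributes. *)
  have nk : n.+1 = k by lia.
  rewrite kbonacci_rec // nk altbin_shiftS eqxx !shift0 //; [|lia|lia].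
  have -> : (k == j) = false by lia.
  rewrite mulr0 !subr0 add0r.
  have jI : (k - j \in index_iota 1 k.+1)%N by rewrite mem_index_iota; lia.
  rewrite (bigD1_seq (k - j)%N) ?iota_uniq //= big_nat_cond big1 ?addr0.
    by rewrite kbonacci_init; [case: eqP; lia | lia].
  by move=> i Hi; rewrite kbonacci_init; [case: eqP; lia | lia].
rewrite kbonacci_rec2 // !IHn; [|lia|lia].
rewrite subSn; last by lia.
rewrite (altbin_shiftS k n.+1) (altbin_shiftS k (n - j)).
have -> : (n.+1 - k = (n - k).+1)%N by lia.
have -> : (n - k - j = n - j - k)%N by lia.
(* The correction at n-j from [altbin_shiftS] matches the one in the formula for B_(n-k). *)
have -> : (n - j == k)%N = (n - k == j)%N by lia.
have -> : (n.+1 == k) = false by lia.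
have -> : (n == j) = false by lia.
have -> : (n.+1 == j) = false by lia.
by ring.
Qed.

Theorem theorem3 (k j n : nat) (hk : (2 <= k)%N) (hj : (j <= k - 1)%N)
    (hn : (j + 1 <= n)%N) :
  kbonacci k j n =
    - (\sum_(1 <= i < ((n + 1) %/ (k + 1)).+1)
         (-1) ^+ i * 'C(n - i * k, i - 1)%:Z * 2%:Z ^+ (n + 1 - i * (k + 1)))
    + \sum_(1 <= i < ((n - j) %/ (k + 1)).+1)
         (-1) ^+ i * 'C(n - j - 1 - i * k, i - 1)%:Z
           * 2%:Z ^+ (n - j - i * (k + 1)).
Proof.
rewrite kbonacci_altbin_shift; last by lia.
rewrite (sum_altbin_shift k (n - j)).
have := sum_altbin_shift k (n + 1); rewrite addnK => ->.
(* Since n > j, the correction [n = j] vanishes. *)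
have -> : (n == j) = false by lia.
by rewrite opprK addr0 addn1.
Qed.
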